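(* Let $(X,\tau,E)$ be a soft topological space. If $(X,\tau,E)$ is soft weakly locally connected, then it is soft locally connected.
   Context: Let $X$ be a set and $E$ a nonempty set of parameters. A soft set $(F,E)$ over $X$ is a map $F:E\to\mathcal{P}(X)$; $SS(X)_E$ is the family of all of them. Unions and intersections are taken parameterwise, and $(F,E)\widetilde{\subseteq}(G,E)$ means $F(e)\subseteq G(e)$ for all $e\in E$. For $x\in X$, $x\in(F,E)$ (read ''$(F,E)$ contains $x$'') means $x\in F(e)$ for all $e\in E$. $\Phi_E$ is the null soft set $e\mapsto\emptyset$; for $Y\subseteq X$, $\widetilde{Y}$ is the soft set $e\mapsto Y$. A soft topological space $(X,\tau,E)$ is given by a family $\tau\subseteq SS(X)_E$ containing $\Phi_E$ and $\widetilde{X}$ and closed under arbitrary unions and finite intersections; members of $\tau$ are called soft open. The space is soft connected if there are no two soft open sets, both different from $\Phi_E$, whose union is $\widetilde{X}$ and whose intersection is $\Phi_E$. For nonempty $Y\subseteq X$, the soft subspace $(Y,\tau_Y,E)$ has $\tau_Y=\{\widetilde{Y}\cap(F,E):(F,E)\in\tau\}$. $(X,\tau,E)$ is soft locally connected at $x\in X$ if for every soft open set $(F,E)$ containing $x$ there is a subset $G\subseteq X$ with $x\in G$, $\widetilde{G}\in\tau$, $\widetilde{G}\,\widetilde{\subseteq}\,(F,E)$, and $(G,\tau_G,E)$ soft connected. It is soft locally connected if this holds at every $x\in X$. $(X,\tau,E)$ is soft weakly locally connected at $x\in X$ if for every soft open set $(F,E)$ containing $x$ there are a soft connected soft subspace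 $(Z,\tau_Z,E)$ of $(X,\tau,E)$ with $\widetilde{Z}\,\widetilde{\subseteq}\,(F,E)$ and a soft open set $(H,E)$ containing $x$ with $(H,E)\,\widetilde{\subseteq}\,\widetilde{Z}$. It is soft weakly locally connected if this holds at every $x\in X$. *)

(* Defs.v *)
From mathcomp Require Import all_boot boolp classical_sets.

Set Implicit Arguments.
Unset Strict Implicit.
Unset Printing Implicit Defensive.

Local Open Scope classical_set_scope.

(* All soft sets live over an ambient type [T]; the underlying set of a soft
   space is a carrier [X : set T].  This way a soft space over [X] and its soft
   subspace over [Y] are objects of the same kind, and the soft open sets of the
   subspace are literally the intersections of [Y]~ with those of the space. *)
Definition soft_set (T E : Type) := E -> set T.

Section SoftSets.
Variables T E : Type.
Implicit Types (F G : soft_set T E) (D : set (soft_set T E)) (Y : set T).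

Definition soft_null : soft_set T E := fun=> set0.

Definition soft_const Y : soft_set T E := fun=> Y.

Definition soft_subset F G : Prop := forall e, F e `<=` G e.

Definition soft_in (x : T) F : Prop := forall e, F e x.

Definition soft_union F G : soft_set T E := fun e => F e `|` G e.

Definition soft_inter F G : soft_set T E := fun e => F e `&` G e.

Definition soft_bigcup D : soft_set T E := fun e => \bigcup_(F in D) F e.

End SoftSets.

Arguments soft_null {T E}.
Arguments soft_const {T} E Y.

Section SoftTopology.
Variables T E : Type.
Implicit Types (X Y : set T) (tau : set (soft_set T E)) (x : T).

Record soft_topology X tau : Prop := SoftTopology {
  soft_open_sub : forall F, tau F -> soft_subset F (soft_const E X);
  soft_open_null : tau soft_null;
  soft_open_full : tau (soft_const E X);
  soft_open_bigcup : forall D, D `<=` tau -> tau (soft_bigcup D);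
  soft_open_inter : forall F G, tau F -> tau G -> tau (soft_inter F G)
}.

Definition soft_subspace tau Y : set (soft_set T E) :=
  [set soft_inter (soft_const E Y) F | F in tau].

Definition soft_connected X tau : Prop :=
  ~ exists F G : soft_set T E,
      [/\ tau F /\ tau G, F <> soft_null, G <> soft_null,
          soft_union F G = soft_const E X & soft_inter F G = soft_null].

Definition soft_locally_connected_at X tau x : Prop :=
  forall F, tau F -> soft_in x F ->
    exists G : set T,
      [/\ G `<=` X, G x, tau (soft_const E G),
          soft_subset (soft_const E G) F
        & soft_connected G (soft_subspace tau G)].

Definition soft_locally_connected X tau : Prop :=
  forall x, X x -> soft_locally_connected_at X tau x.

Definition soft_weakly_locally_connected_at X tau x : Prop :=
  forall F, tau F -> soft_in x F ->
    exists Z : set T,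
      [/\ Z `<=` X, Z !=set0, soft_connected Z (soft_subspace tau Z),
          soft_subset (soft_const E Z) F
        & exists H : soft_set T E,
            [/\ tau H, soft_in x H & soft_subset H (soft_const E Z)]].

Definition soft_weakly_locally_connected X tau : Prop :=
  forall x, X x -> soft_weakly_locally_connected_at X tau x.

Lemma soft_subspace_topology X tau Y :
  soft_topology X tau -> Y `<=` X -> soft_topology Y (soft_subspace tau Y).
Proof.
case=> _ tau0 tauX tauU tauI YX; split.
- by move=> _ [F _ <-] e x [].
- by exists soft_null => //; apply/funext => e; rewrite /soft_inter setI0.
- exists (soft_const E X) => //; apply/funext => e.
  exact/setIidPl.
- move=> D DY.
  pose D' := [set F | tau F /\ D (soft_inter (soft_const E Y) F)].
  exists (soft_bigcup D'); first by apply: tauU => F [].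
  apply/funext => e; apply/seteqP; split=> x /=.
    by case=> Yx [F [tF DF] Fx]; exists (soft_inter (soft_const E Y) F).
  case=> G DG; have [F tF FG] := DY _ DG.
  rewrite -FG => -[Yx Fx]; split=> //; exists F => //; split=> //.
  by rewrite FG.
- move=> _ _ [F tF <-] [G tG <-]; exists (soft_inter F G); first exact: tauI.
  by apply/funext => e; rewrite /soft_inter setIACA setIid.
Qed.

End SoftTopology.

(* Main.v *)
Require Import Defs.
From mathcomp Require Import all_boot boolp classical_sets.

(** The candidate neighbourhood of [x] inside [F] is the union [C] of all soft
    connected subspaces that contain [x] and lie in [F].  Soft connected
    subspaces with a common point have a soft connected union, so [C] is soft
    connected and absorbs every soft connected subspace of [F] that meets it.
    Weak local connectedness at each [y] in [C] thus places a soft open set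
    containing [y] inside [C], and [C] is the union of these. *)

Local Open Scope classical_set_scope.

Section SoftConnected.
Variables (T E : Type) (tau : set (soft_set T E)).
Implicit Types (A B : soft_set T E) (Y Z : set T).

(** If both inclusions failed, the traces of [A] and [B] on [Z] would be non-null and would separate
    [Z]. The same side serves every parameter, so the position of one point of [Z] at one parameter
    settles all of them. *)
Lemma soft_connected_subspace_sub Z A B :
    soft_connected Z (soft_subspace tau Z) -> tau A -> tau B ->
    (forall e, Z `<=` A e `|` B e) -> (forall e, Z `&` (A e `&` B e) = set0) ->
  (forall e, Z `<=` A e) \/ (forall e, Z `<=` B e).
Proof.
move=> Zconn tA tB ZAB ZAB0; apply: contrapT => /not_orP[ZA ZB].
apply: Zconn; exists (soft_inter (soft_const E Z) A),
  (soft_inter (soft_const E Z) B); split.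
- by split; [exists A | exists B].
- move=> A0; apply: ZB => e z Zz; case: (ZAB e z Zz) => // Az.
  by have : soft_inter (soft_const E Z) A e z by []; rewrite A0.
- move=> B0; apply: ZA => e z Zz; case: (ZAB e z Zz) => // Bz.
  by have : soft_inter (soft_const E Z) B e z by []; rewrite B0.
- by apply/funext => e; rewrite /soft_union -setIUr; apply/setIidPl.
- by apply/funext => e; rewrite /soft_inter setIACA setIid ZAB0.
Qed.

Lemma soft_connected_bigcup (D : set (set T)) (p : T) :
    inhabited E -> (forall Z, D Z -> Z p) ->
    (forall Z, D Z -> soft_connected Z (soft_subspace tau Z)) ->
  soft_connected (\bigcup_(Z in D) Z) (soft_subspace tau (\bigcup_(Z in D) Z)).
Proof.
move=> [e0] Dp Dconn; set C := \bigcup_(Z in D) Z.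
case=> _ [_ [[[A tA <-] [B tB <-]] A0 B0 AB AB0]].
have CAB e z : C z -> A e z \/ B e z.
  move=> Cz; have : soft_const E C e z by [].
  by rewrite -AB => -[[_ ?]|[_ ?]]; [left | right].
have CAB0 e z : C z -> A e z -> B e z -> False.
  move=> Cz Az Bz; suff : @soft_null T E e z by [].
  by rewrite -AB0.
have DAB Z : D Z -> (forall e, Z `<=` A e) \/ (forall e, Z `<=` B e).
  move=> DZ; apply: soft_connected_subspace_sub => //; first exact: Dconn.
  - by move=> e z Zz; apply: CAB; exists Z.
  - move=> e; apply/seteqP; split=> // z [Zz [Az Bz]].
    by apply: (CAB0 e z) => //; exists Z.
have Cp Z : D Z -> C p by move=> DZ; exists Z => //; exact: Dp.
(* The side of the separation containing [p] at the parameter [e0] contains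
   every member of [D], so the other side is null. *)
have [Ap|nAp] := pselect (A e0 p).
- apply: B0; apply/funext => e; apply/seteqP; split=> // z [[Z DZ Zz] Bz].
  have [ZA|ZB] := DAB Z DZ.
    by apply: (CAB0 e z) => //; [exists Z | exact: ZA].
  by apply: (CAB0 e0 p) => //; [exact: Cp DZ | exact: ZB (Dp Z DZ)].
- apply: A0; apply/funext => e; apply/seteqP; split=> // z [[Z DZ Zz] Az].
  have [ZA|ZB] := DAB Z DZ; first by apply: nAp; exact: ZA (Dp Z DZ).
  by apply: (CAB0 e z) => //; [exists Z | exact: ZB].
Qed.

Lemma soft_connected_setU Y Z (p : T) :
    inhabited E -> Y p -> Z p ->
    soft_connected Y (soft_subspace tau Y) ->
    soft_connected Z (soft_subspace tau Z) ->
  soft_connected (Y `|` Z) (soft_subspace tau (Y `|` Z)).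
Proof.
move=> E0 Yp Zp Yconn Zconn.
have -> : Y `|` Z = \bigcup_(W in [set Y; Z]) W by rewrite bigcup_setU !bigcup_set1.
by apply: (@soft_connected_bigcup _ p) => // W [] ->.
Qed.

End SoftConnected.

Theorem theorem2p37 (T E : Type) (X : set T) (tau : set (soft_set T E))
    (E_nonempty : inhabited E) (tau_topology : soft_topology X tau) :
  soft_weakly_locally_connected X tau -> soft_locally_connected X tau.
Proof.
move=> wlc x Xx F tF Fx; have [e0] := E_nonempty.
pose D : set (set T) := [set Z | [/\ Z `<=` X, Z x,
  soft_subset (soft_const E Z) F & soft_connected Z (soft_subspace tau Z)]].
pose C := \bigcup_(Z in D) Z.
have CX : C `<=` X by move=> y [Z [ZX _ _ _] Zy]; exact: ZX.
have CF : soft_subset (soft_const E C) F.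
  by move=> e y [Z [_ _ ZF _] Zy]; exact: ZF.
(* The case [y = x] is kept apart because [C x] is not known yet: it follows from this very claim at
   [x]. *)
have Cnbhs y : X y -> soft_in y F -> (y = x \/ C y) ->
    exists H, [/\ tau H, soft_in y H & soft_subset H (soft_const E C)].
  move=> Xy Fy yC.
  have [Z [ZX _ Zconn ZF [H [tH Hy HZ]]]] := wlc y Xy F tF Fy.
  have Zy : Z y by exact: HZ (Hy e0).
  suff ZC : Z `<=` C by exists H; split=> // e z /HZ /ZC.
  case: yC => [yx|[Y [YX Yx YF Yconn] Yy]].
    by move=> z Zz; exists Z => //; split=> //; rewrite -yx.
  (* [Y] and [Z] share [y], and [Y] contains [x], so their union is again a member of [D]. *)
  move=> z Zz; exists (Y `|` Z); last by right.
  split; [by rewrite subUset | by left | | exact: soft_connected_setU Yy Zy _ _].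
  by move=> e w [/(YF e)|/(ZF e)].
exists C; split=> //.
- have [H [_ Hx HC]] := Cnbhs x Xx Fx (or_introl erefl).
  exact: HC (Hx e0).
(* A soft open [H] may vary with the parameter. The union of all those inside [C] is nevertheless
   constant, since each point of [C] belongs to one of them at every parameter. *)
- pose O := [set H | tau H /\ soft_subset H (soft_const E C)].
  have -> : soft_const E C = soft_bigcup O.
    apply/funext => e; apply/seteqP; split=> y; last by case=> H [_ HC] /HC.
    move=> Cy; have Fy : soft_in y F by move=> e'; exact: CF.
    have [H [tH Hy HC]] := Cnbhs y (CX y Cy) Fy (or_intror Cy).
    by exists H => //; exact: Hy.
  by apply: (soft_open_bigcup tau_topology) => H [].
- by apply: (@soft_connected_bigcup _ _ _ _ x) => // Z [].
Qed.
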